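(* Let $p>1$ and let $c$ be a real constant. Let $(\lambda_n)_{n\ge1}$ and $(x_n)_{n\ge1}$ be sequences of positive real numbers, and put $$\Lambda_n=\sum_{k=1}^n\lambda_k,\quad \Lambda^*_n=\sum_{k=n}^\infty\lambda_k,\quad A_n=\sum_{k=1}^n\frac{\lambda_kx_k}{\Lambda_n},\quad A^*_n=\sum_{k=n}^\infty\frac{\lambda_kx_k}{\Lambda^*_n}.$$ Then the following inequalities hold: (1) if $1<c\le p$, then $$\sum_{n=1}^\infty\lambda_n\Lambda_n^{p-c}A_n^p\le\frac{p}{c-1}\sum_{n=1}^\infty\lambda_n\Lambda_n^{p-c}x_nA_n^{p-1};$$ (2) if $0\le c<1$, then $$\sum_{n=1}^\infty\lambda_n\Lambda_n^{p-c}\left(\frac1{\Lambda_n}\sum_{k=n}^\infty\lambda_kx_k\right)^p\le\frac{p}{1-c}\sum_{n=1}^\infty\lambda_n\Lambda_n^{p-c}x_n\left(\frac1{\Lambda_n}\sum_{k=n}^\infty\lambda_kx_k\right)^{p-1};$$ (3) if $0\le c<1$, then $$\sum_{n=1}^\infty\lambda_n{\Lambda^*_n}^{p-c}\left(\frac1{\Lambda^*_n}\sum_{k=1}^n\lambda_kx_k\right)^p\le\frac{p}{1-c}\sum_{n=1}^\infty\lambda_n{\Lambda^*_n}^{p-c}x_n\left(\frac1{\Lambda^*_n}\sum_{k=1}^n\lambda_kx_k\right)^{p-1};$$ (4) if $1<c\le p$, then $$\sum_{n=1}^\infty\lambda_n{\Lambda^*_n}^{p-c}{A^*_n}^p\l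e\frac{p}{c-1}\sum_{n=1}^\infty\lambda_n{\Lambda^*_n}^{p-c}x_n{A^*_n}^{p-1}.$$
   Context: Standing assumption: all infinite sums appearing in the inequality under consideration are assumed to converge (in particular, $\sum_n\lambda_n<\infty$ in (3) and (4), where $\Lambda^*_n$ is used). *)

(* Defs.v *)
From HB Require Import structures.
From mathcomp Require Import all_boot all_order all_algebra.
From mathcomp Require Import all_classical all_reals all_analysis.

Set Implicit Arguments.
Unset Strict Implicit.
Unset Printing Implicit Defensive.

Import Order.TTheory GRing.Theory Num.Theory.
Import numFieldNormedType.Exports.

Local Open Scope ring_scope.

(* Sequences are indexed from 1; the value at 0 is never used. *)
Section Definitions.
Context {R : realType}.
Implicit Types lambda x u : nat -> R.

(* [limn] is total, so convergence has to be assumed separately. *)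
Definition infsum (m : nat) u : R := limn (fun N => \sum_(m <= k < N) u k).

Definition converges (m : nat) u : Prop :=
  cvgn (fun N => \sum_(m <= k < N) u k).

Definition Lambda lambda (n : nat) : R := \sum_(1 <= k < n.+1) lambda k.

Definition Lambda_star lambda (n : nat) : R := infsum n lambda.

Definition A lambda x (n : nat) : R :=
  \sum_(1 <= k < n.+1) lambda k * x k / Lambda lambda n.

Definition A_star lambda x (n : nat) : R :=
  infsum n (fun k => lambda k * x k / Lambda_star lambda n).

End Definitions.

(* Main.v *)
Require Import Defs.
From HB Require Import structures.
From mathcomp Require Import all_boot all_order all_algebra.
From mathcomp Require Import all_classical all_reals all_analysis.
From mathcomp Require Import ring lra.

Set Implicit Arguments.
Unset Strict Implicit.
Unset Printing Implicit Defensive.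

Import Order.TTheory GRing.Theory Num.Theory.
Import numFieldNormedType.Exports.

(** Write [y n = lambda n * x n], let [W n] be the head sum [Lambda lambda n]
    or the tail sum [Lambda_star lambda n] of the weights, and [S n] the head
    or tail sum of [y].  After the powers of [W n] are collected, all four
    inequalities read
      [|c - 1| * \sum lambda n * W n `^ (- c) * S n `^ p
         <= p * \sum y n * W n `^ (1 - c) * S n `^ (p - 1)].
    Both [lambda n] and [y n] are differences of neighbouring sums, [L - l] and
    [S - s], and the inequality holds term by term up to a telescoping
    difference:
    - for [1 < c <= p] ([step_gt1]) the correction is
      [l `^ (1 - c) * s `^ p - L `^ (1 - c) * S `^ p], which telescopes when
      both sums are heads or both are tails;
    - for [0 <= c < 1] ([step_lt1]) it is
      [L `^ (1 - c) * s `^ p - l `^ (1 - c) * S `^ p], which telescopes when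
      one sum is a head and the other a tail, as their neighbours then lie on
      opposite sides of [n].
    By homogeneity each step reduces to a statement on [u = l / L] and
    [v = s / S], which follows from two uses of Bernoulli's inequality
    ([powR_ge_tangent], [powR_le_tangent]).

    Summation leaves one boundary term.  When [S] is a head sum it has the
    right sign ([finite_sum_head_head], [finite_sum_tail_head]) and the
    inequality holds between partial sums.  When [S] is a tail sum the boundary
    term at infinity has the wrong sign, so the tail of [y] is cut off at
    [N]: the boundary term then vanishes ([finite_sum_head_tail],
    [finite_sum_tail_tail]), the right-hand side only decreases, and the
    left-hand side is recovered as [N] grows ([infsum_le_of_truncations]). *)

Local Open Scope ring_scope.

(** * Bernoulli's inequality and the term-by-term estimates *)

Section BernoulliInequalities.
Context {R : realType}.
Implicit Types p c t u v L l S s : R.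

(** Bernoulli's inequality, as the case [b = 1] of Young's inequality
    [a * b <= a `^ p / p + b `^ q / q]. *)
Lemma powR_ge_tangent p u : 1 <= p -> 0 <= u -> 1 + p * (u - 1) <= u `^ p.
Proof.
rewrite le_eqVlt => /predU1P[<- u0|p1 u0]; first by rewrite powRr1//; lra.
have p0 : 0 < p by lra.
have pm0 : 0 < p - 1 by lra.
have := @conjugate_powR R u 1 p (p / (p - 1)) u0 ler01 p0 (divr_gt0 p0 pm0).
have -> : p^-1 + (p / (p - 1))^-1 = 1 by field; rewrite !gt_eqF.
move=> /(_ erefl); rewrite powR1 mulr1 -(ler_pM2l p0) => H.
have E : p * (u `^ p / p + 1 / (p / (p - 1))) = u `^ p + (p - 1).
  by field; rewrite !gt_eqF.
by rewrite E in H; lra.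
Qed.

(** The concave counterpart: apply the convex one to [u `^ t] with the exponent
    [t^-1]. *)
Lemma powR_le_tangent t u : 0 < t <= 1 -> 0 <= u -> u `^ t <= 1 + t * (u - 1).
Proof.
move=> /andP[t0 t1] u0.
have := @powR_ge_tangent t^-1 (u `^ t); rewrite invf_ge1// => /(_ t1 (powR_ge0 _ _)).
rewrite -powRrM divff ?gt_eqF// powRr1// -(ler_pM2l t0) => H.
have E : t * (1 + t^-1 * (u `^ t - 1)) = t + u `^ t - 1.
  by field; rewrite gt_eqF.
by rewrite E in H; lra.
Qed.

(** For fixed [u] the right-hand side is convex in [v] with its minimum at
    [z = u `^ t], [t = (c - 1) / (p - 1)]; the tangent at that point reduces the
    claim to [z <= 1 + t * (u - 1)], which is concavity since [c <= p] gives
    [t <= 1].  At [u = 0] the value [0 `^ (1 - c)] is [0] instead of [+oo],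
    whence the condition relating [u] and [v]; there the claim is [c <= p]. *)
Lemma normalized_step_gt1 p c u v : 1 < p -> 1 < c <= p -> 0 <= u -> 0 <= v ->
  (u = 0 -> v = 0) ->
  (c - 1) * (1 - u) <= p * (1 - v) + (u `^ (1 - c) * v `^ p - 1).
Proof.
move=> p1 /andP[c1 cp] u0 v0 uv.
have [u_eq0|u_neq0] := eqVneq u 0.
  by rewrite u_eq0 (uv u_eq0) (@powR0 _ p) ?gt_eqF//; lra.
have up : 0 < u by rewrite lt_def u_neq0.
set t := (c - 1) / (p - 1).
have t0 : 0 < t by rewrite divr_gt0//; lra.
have t1 : t <= 1 by rewrite ler_pdivrMr; lra.
have tp : t * (p - 1) = c - 1 by rewrite divfK// gt_eqF//; lra.
set z := u `^ t.
have z0 : 0 < z by exact: powR_gt0.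
have zle : z <= 1 + t * (u - 1) by apply: powR_le_tangent => //; rewrite t0.
have -> : u `^ (1 - c) * v `^ p = z * (v / z) `^ p.
  have {1}-> : v = z * (v / z) by rewrite mulrC divfK// gt_eqF.
  rewrite powRM ?divr_ge0 ?(ltW z0)// mulrA; congr (_ * _).
  rewrite -powRrM -powRD; last by rewrite u_neq0 implybT.
  by congr (_ `^ _); rewrite -(opprB c) -tp; ring.
have := @powR_ge_tangent p (v / z) (ltW p1) (divr_ge0 v0 (ltW z0)).
rewrite -(ler_pM2l z0).
have -> : z * (1 + p * (v / z - 1)) = z + p * v - p * z.
  by field; rewrite gt_eqF.
move=> H.
have : (p - 1) * z <= (p - 1) * (1 + t * (u - 1)) by rewrite ler_pM2l//; lra.
have -> : (p - 1) * (1 + t * (u - 1)) = p - 1 + (t * (p - 1)) * (u - 1) by ring.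
rewrite tp => H2; nra.
Qed.

(** Here [u] and [v] are not coupled: the claim is the sum of a tangent bound
    for the convex power [p] and one for the concave power [1 - c]. *)
Lemma normalized_step_lt1 p c u v : 1 < p -> 0 <= c < 1 -> 0 <= u -> 0 <= v ->
  (1 - c) * (1 - u) <= p * (1 - v) + (v `^ p - u `^ (1 - c)).
Proof.
move=> p1 /andP[c0 c1] u0 v0.
have := @powR_ge_tangent p v (ltW p1) v0.
have := @powR_le_tangent (1 - c) u; rewrite subr_gt0 c1 gerBl c0 => /(_ erefl u0).
by move=> H1 H2; nra.
Qed.

Lemma powR_quotient a b t : 0 < a -> 0 <= b -> b `^ t = a `^ t * (b / a) `^ t.
Proof.
move=> a0 b0; rewrite -powRM ?divr_ge0 ?(ltW a0)//.
by rewrite mulrC divfK// gt_eqF.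
Qed.

Lemma powR_split c L : 0 < L -> L `^ (1 - c) = L * L `^ (- c).
Proof.
by move=> L0; rewrite powRD ?powRr1 ?(ltW L0)// (gt_eqF L0) implybT.
Qed.

(** [normalized_step_gt1] at [u = l / L], [v = s / S], multiplied by
    [L `^ (1 - c) * S `^ p].  In the applications [l] and [s] are the next
    smaller sums: the preceding ones for heads, the following ones for tails. *)
Lemma step_gt1 p c L l S s : 1 < p -> 1 < c <= p ->
  0 < L -> 0 <= l -> 0 < S -> 0 <= s -> (l = 0 -> s = 0) ->
  (c - 1) * ((L - l) * L `^ (- c) * S `^ p) <=
  p * ((S - s) * L `^ (1 - c) * S `^ (p - 1)) +
  (l `^ (1 - c) * s `^ p - L `^ (1 - c) * S `^ p).
Proof.
move=> p1 hc L0 l0 S0 s0 ls.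
have uv : l / L = 0 -> s / S = 0.
  by move/eqP; rewrite mulf_eq0 invr_eq0 (gt_eqF L0) orbF => /eqP/ls ->; rewrite mul0r.
have := normalized_step_gt1 p1 hc (divr_ge0 l0 (ltW L0)) (divr_ge0 s0 (ltW S0)) uv.
rewrite (powR_quotient (1 - c) L0 l0) (powR_quotient p S0 s0).
rewrite -(@mulr_powRB1 _ S p (ltW S0)) ?(powR_split c L0); last lra.
set P := S `^ (p - 1); set Q := L `^ (- c).
have PQ : 0 < (L * Q) * (S * P) by rewrite !mulr_gt0// powR_gt0.
rewrite -(ler_pM2l PQ) => H.
apply: le_trans (le_trans H _); rewrite le_eqVlt; apply/orP; left; apply/eqP.
  by field; rewrite gt_eqF.
by field; rewrite gt_eqF.
Qed.

(** [normalized_step_lt1], rescaled in the same way. *)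
Lemma step_lt1 p c L l S s : 1 < p -> 0 <= c < 1 ->
  0 < L -> 0 <= l -> 0 < S -> 0 <= s ->
  (1 - c) * ((L - l) * L `^ (- c) * S `^ p) <=
  p * ((S - s) * L `^ (1 - c) * S `^ (p - 1)) +
  (L `^ (1 - c) * s `^ p - l `^ (1 - c) * S `^ p).
Proof.
move=> p1 hc L0 l0 S0 s0.
have := normalized_step_lt1 p1 hc (divr_ge0 l0 (ltW L0)) (divr_ge0 s0 (ltW S0)).
rewrite (powR_quotient (1 - c) L0 l0) (powR_quotient p S0 s0).
rewrite -(@mulr_powRB1 _ S p (ltW S0)) ?(powR_split c L0); last lra.
set P := S `^ (p - 1); set Q := L `^ (- c).
have PQ : 0 < (L * Q) * (S * P) by rewrite !mulr_gt0// powR_gt0.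
rewrite -(ler_pM2l PQ) => H.
apply: le_trans (le_trans H _); rewrite le_eqVlt; apply/orP; left; apply/eqP.
  by field; rewrite gt_eqF.
by field; rewrite gt_eqF.
Qed.

Lemma cvg_powR (F : nat -> R) s p : 0 < s -> (F @ \oo --> s)%classic ->
  ((fun n => F n `^ p) @ \oo --> s `^ p)%classic.
Proof.
move=> s0 Fs; have : {for s, continuous (fun t : R => t `^ p)}.
  apply: differentiable_continuous; apply/derivable1_diffP.
  by apply: derivable_powR; rewrite in_itv/= s0.
exact: (cvg_comp F (fun t => t `^ p) Fs).
Qed.

End BernoulliInequalities.

(** * Partial sums and limits of series with positive terms *)

Section PositiveSeries.
Context {R : realType}.
Implicit Types (f g y u v : nat -> R) (m n N : nat) (B d p : R).

Lemma partial_sums_eq m u v : (forall n, (m <= n)%N -> u n = v n) ->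
  (fun N => \sum_(m <= k < N) u k) = (fun N => \sum_(m <= k < N) v k).
Proof.
move=> uv; apply/funext => N.
by apply: eq_big_nat => k /andP[mk _]; exact: uv.
Qed.

Lemma eq_infsum m u v : (forall n, (m <= n)%N -> u n = v n) ->
  infsum m u = infsum m v.
Proof. by move=> uv; rewrite /infsum (partial_sums_eq uv). Qed.

Lemma eq_converges m u v : (forall n, (m <= n)%N -> u n = v n) ->
  converges m u -> converges m v.
Proof. by move=> uv; rewrite /converges (partial_sums_eq uv). Qed.

Lemma partial_sums_nondecreasing m u : (forall n, (m <= n)%N -> 0 <= u n) ->
  nondecreasing_seq (fun N => \sum_(m <= k < N) u k).
Proof.
move=> u0; apply/nondecreasing_seqP => N.
have [mN|Nm] := leqP m N; first by rewrite big_nat_recr//= lerDl u0.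
by rewrite !big_geq// ltnW.
Qed.

Lemma partial_le_infsum m u : (forall n, (m <= n)%N -> 0 <= u n) ->
  converges m u -> forall N, \sum_(m <= k < N) u k <= infsum m u.
Proof. by move=> u0; apply/nondecreasing_cvgn_le/partial_sums_nondecreasing. Qed.

Lemma infsum_le m u B : converges m u ->
  (forall N, \sum_(m <= k < N) u k <= B) -> infsum m u <= B.
Proof. by move=> cu uB; apply: limr_le => //; apply: nearW => N; exact: uB. Qed.

Lemma cvg_finite_sum m M (u : nat -> nat -> R) (l : nat -> R) :
  (forall n, (m <= n)%N -> ((fun N => u N n) @ \oo --> l n)%classic) ->
  ((fun N => \sum_(m <= n < M) u N n) @ \oo --> \sum_(m <= n < M) l n)%classic.
Proof.
move=> cu; elim: M => [|M IH].
  by under eq_fun do rewrite big_geq//; rewrite big_geq//; exact: cvg_cst.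
have [mM|Mm] := leqP m M; last first.
  by under eq_fun do rewrite big_geq//; rewrite big_geq//; exact: cvg_cst.
under eq_fun do rewrite big_nat_recr//=.
by rewrite big_nat_recr//=; apply: cvgD => //; exact: cu.
Qed.

Lemma infsum_recl n y : converges n.+1 y -> infsum n y = y n + infsum n.+1 y.
Proof.
move=> cy; apply/cvg_lim => //.
apply: (@cvg_trans _ ((fun N => y n + \sum_(n.+1 <= k < N) y k) @ \oo)%classic).
  apply: near_eq_cvg; near=> N; rewrite [RHS]big_ltn//.
  by near: N; exact: nbhs_infty_gt.
by apply: cvgD; [exact: cvg_cst|exact: cy].
Unshelve. all: by end_near. Qed.

Lemma infsum_gt0 n y : (forall k, (n <= k)%N -> 0 < y k) -> converges n y ->
  0 < infsum n y.
Proof.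
move=> y0 cy; apply: (@lt_le_trans _ _ (y n)); first exact: y0.
have -> : y n = \sum_(n <= k < n.+1) y k by rewrite big_nat1.
by apply: partial_le_infsum => // k /y0/ltW.
Qed.

Lemma convergesMr n y (a : R) : converges n y -> converges n (fun k => y k * a).
Proof.
move=> cy; rewrite /converges.
under eq_fun do rewrite -mulr_suml.
by apply: is_cvgM => //; exact: is_cvg_cst.
Qed.

Lemma infsumMr n y (a : R) : converges n y ->
  infsum n (fun k => y k * a) = infsum n y * a.
Proof.
move=> cy; rewrite /infsum.
under eq_fun do rewrite -mulr_suml.
by apply/cvg_lim => //; apply: cvgM; [exact: cy|exact: cvg_cst].
Qed.

Lemma telescoping_sum_le d p f g (Phi : nat -> R) N :
  (forall n, (1 <= n < N)%N -> d * f n <= p * g n + (Phi n.+1 - Phi n)) ->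
  Phi N <= Phi 1%N ->
  d * \sum_(1 <= n < N) f n <= p * \sum_(1 <= n < N) g n.
Proof.
move=> step PhiN.
have [->|N0] := posnP N; first by rewrite !big_geq// !mulr0.
rewrite !mulr_sumr.
apply: (@le_trans _ _ (\sum_(1 <= n < N) (p * g n + (Phi n.+1 - Phi n)))).
  exact: ler_sum_nat.
by rewrite big_split/= telescope_sumr// gerDl subr_le0.
Qed.

Lemma infsum_le_of_partial_sums d p f g : 0 < d -> 0 <= p ->
  (forall n, (1 <= n)%N -> 0 <= g n) -> converges 1 f -> converges 1 g ->
  (forall N, d * \sum_(1 <= n < N) f n <= p * \sum_(1 <= n < N) g n) ->
  infsum 1 f <= p / d * infsum 1 g.
Proof.
move=> d0 p0 g0 cf cg H; apply: infsum_le => // N.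
rewrite mulrAC ler_pdivlMr// mulrC (le_trans (H N))//.
by rewrite ler_wpM2l// partial_le_infsum.
Qed.

(** Passage to the limit for sums of tails.  Fix the number [M] of terms on
    the left and let the cut-off [N] of the tails grow: the left side, a finite
    sum of continuous functions of the truncated tails, converges, while the
    right side stays below the full series because the powers [q >= 0] increase
    with the truncated tails. Thus the limits are never exchanged. *)
Lemma infsum_le_of_truncations d p q (y f g : nat -> R) :
  0 < d -> 0 <= p -> 0 <= q ->
  (forall n, (1 <= n)%N -> 0 < y n) -> (forall n, (1 <= n)%N -> converges n y) ->
  (forall n, (1 <= n)%N -> 0 <= f n) -> (forall n, (1 <= n)%N -> 0 <= g n) ->
  converges 1 (fun n => f n * infsum n y `^ p) ->
  converges 1 (fun n => g n * infsum n y `^ q) ->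
  (forall N, d * \sum_(1 <= n < N) f n * (\sum_(n <= k < N) y k) `^ p <=
             p * \sum_(1 <= n < N) g n * (\sum_(n <= k < N) y k) `^ q) ->
  infsum 1 (fun n => f n * infsum n y `^ p) <=
  p / d * infsum 1 (fun n => g n * infsum n y `^ q).
Proof.
move=> d0 p0 q0 y0 cy f0 g0 cf cg trunc; apply: infsum_le => // M.
have y0' n : (1 <= n)%N -> forall k, (n <= k)%N -> 0 < y k.
  by move=> n1 k nk; apply: y0; exact: leq_trans nk.
have sum0 n N : (1 <= n)%N -> 0 <= \sum_(n <= k < N) y k.
  move=> n1; rewrite big_nat; apply: sumr_ge0 => k /andP[nk _].
  exact/ltW/(y0' n).
set F := fun N => \sum_(1 <= n < M) f n * (\sum_(n <= k < N) y k) `^ p.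
have cF : (F @ \oo --> \sum_(1 <= n < M) f n * infsum n y `^ p)%classic.
  apply: cvg_finite_sum => n n1; apply: cvgM; first exact: cvg_cst.
  apply: cvg_powR; last exact: cy.
  by apply: infsum_gt0; [exact: y0'|exact: cy].
apply: (cvgr_to_le cF); near=> N.
have MN : (M <= N)%N by near: N; exact: nbhs_infty_ge.
apply: (@le_trans _ _ (\sum_(1 <= n < N) f n * (\sum_(n <= k < N) y k) `^ p)).
  rewrite /F; apply: partial_sums_nondecreasing => // n n1.
  by rewrite mulr_ge0 ?f0 ?powR_ge0.
rewrite mulrAC ler_pdivlMr// mulrC (le_trans (trunc N))// ler_wpM2l//.
apply: (@le_trans _ _ (\sum_(1 <= n < N) g n * infsum n y `^ q)); last first.
  by apply: partial_le_infsum => // n n1; rewrite mulr_ge0 ?g0 ?powR_ge0.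
apply: ler_sum_nat => n /andP[n1 _].
have le_tail : \sum_(n <= k < N) y k <= infsum n y.
  by apply: partial_le_infsum; [move=> k /(y0' n n1)/ltW|exact: cy].
rewrite ler_wpM2l ?g0// ge0_ler_powR// nnegrE ?sum0//.
by rewrite (le_trans _ le_tail)// sum0.
Unshelve. all: by end_near. Qed.

End PositiveSeries.

(** * The four inequalities for finite sums *)

Section FiniteInequalities.
Context {R : realType}.
Variables (p c : R) (lambda y : nat -> R).
Hypothesis p_gt1 : 1 < p.
Hypothesis lambda_gt0 : forall n, (1 <= n)%N -> 0 < lambda n.
Hypothesis y_gt0 : forall n, (1 <= n)%N -> 0 < y n.

Let p_gt0 : 0 < p. Proof. exact: lt_trans ltr01 p_gt1. Qed.

Lemma Lambda0 (u : nat -> R) : Lambda u 0 = 0.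
Proof. by rewrite /Lambda big_geq. Qed.

Lemma LambdaE (u : nat -> R) n : (1 <= n)%N -> Lambda u n = Lambda u n.-1 + u n.
Proof. by move=> n1; rewrite /Lambda prednK// big_nat_recr. Qed.

Lemma Lambda_gt0 (u : nat -> R) n : (forall k, (1 <= k)%N -> 0 < u k) ->
  (1 <= n)%N -> 0 < Lambda u n.
Proof.
move=> u0 n1; rewrite /Lambda big_nat_recr//= ltr_wpDl ?u0//.
by rewrite big_nat sumr_ge0// => k /andP[k1 _]; exact/ltW/u0.
Qed.

Lemma Lambda_ge0 (u : nat -> R) n : (forall k, (1 <= k)%N -> 0 < u k) ->
  0 <= Lambda u n.
Proof. by move=> u0; case: n => [|n]; [rewrite Lambda0|exact/ltW/Lambda_gt0]. Qed.

Lemma Lambda_star_gt0 (u : nat -> R) n : (forall k, (1 <= k)%N -> 0 < u k) ->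
  (1 <= n)%N -> converges n u -> 0 < Lambda_star u n.
Proof.
by move=> u0 n1; apply: infsum_gt0 => k nk; apply: u0; exact: leq_trans nk.
Qed.

Let tail N n := \sum_(n <= k < N) y k.

Let tailE N n : (n < N)%N -> tail N n = y n + tail N n.+1.
Proof. by move=> nN; rewrite /tail big_ltn. Qed.

Let tail_ge0 N n : (1 <= n)%N -> 0 <= tail N n.
Proof.
move=> n1; rewrite /tail big_nat sumr_ge0// => k /andP[nk _].
by apply/ltW/y_gt0; exact: leq_trans nk.
Qed.

Let tail_gt0 N n : (1 <= n < N)%N -> 0 < tail N n.
Proof.
by move=> /andP[n1 nN]; rewrite tailE// ltr_wpDr ?tail_ge0// y_gt0.
Qed.

(** Telescoping runs forward; the term at the start vanishes because
    [Lambda y 0 = 0], and the one at the end is dropped.  The first step starts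
    from [l = s = 0], the degenerate case allowed in [step_gt1]. *)
Lemma finite_sum_head_head N : 1 < c <= p ->
  (c - 1) * \sum_(1 <= n < N)
    lambda n * Lambda lambda n `^ (- c) * Lambda y n `^ p <=
  p * \sum_(1 <= n < N)
    y n * Lambda lambda n `^ (1 - c) * Lambda y n `^ (p - 1).
Proof.
move=> hc; pose Phi n := - (Lambda lambda n.-1 `^ (1 - c) * Lambda y n.-1 `^ p).
apply: (@telescoping_sum_le _ _ _ _ _ Phi) => [n /andP[n1 _]|]; last first.
  rewrite /Phi /= !Lambda0 (@powR0 _ p) ?(gt_eqF p_gt0)// mulr0 oppr0.
  by rewrite oppr_le0 mulr_ge0 ?powR_ge0.
have -> : lambda n = Lambda lambda n - Lambda lambda n.-1.
  by rewrite (LambdaE lambda n1) addrAC subrr add0r.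
have -> : y n = Lambda y n - Lambda y n.-1.
  by rewrite (LambdaE y n1) addrAC subrr add0r.
rewrite /Phi /= opprK [X in _ <= _ + X]addrC.
apply: step_gt1; rewrite ?Lambda_gt0 ?Lambda_ge0//.
case: n n1 => // -[|n] _ /=; first by rewrite !Lambda0.
by move=> E; have := Lambda_gt0 lambda_gt0 (ltn0Sn n); rewrite E ltxx.
Qed.

(** The tail of [y] is cut off at [N], so that the boundary term at [N] is
    zero. *)
Lemma finite_sum_head_tail N : 0 <= c < 1 ->
  (1 - c) * \sum_(1 <= n < N)
    lambda n * Lambda lambda n `^ (- c) * (\sum_(n <= k < N) y k) `^ p <=
  p * \sum_(1 <= n < N)
    y n * Lambda lambda n `^ (1 - c) * (\sum_(n <= k < N) y k) `^ (p - 1).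
Proof.
move=> hc; pose Phi n := Lambda lambda n.-1 `^ (1 - c) * tail N n `^ p.
apply: (@telescoping_sum_le _ _ _ _ _ Phi) => [n /andP[n1 nN]|]; last first.
  rewrite /Phi /tail (@big_geq _ _ _ N N)// (@powR0 _ p) ?(gt_eqF p_gt0)// mulr0.
  by rewrite mulr_ge0 ?powR_ge0.
have -> : lambda n = Lambda lambda n - Lambda lambda n.-1.
  by rewrite (LambdaE lambda n1) addrAC subrr add0r.
have -> : y n = tail N n - tail N n.+1 by rewrite (tailE nN) addrK.
apply: step_lt1; rewrite ?Lambda_gt0 ?Lambda_ge0 ?tail_ge0//.
by rewrite tail_gt0// n1.
Qed.

Hypothesis lambda_cvg : forall n, (1 <= n)%N -> converges n lambda.

Let lambdaE n : (1 <= n)%N ->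
  lambda n = Lambda_star lambda n - Lambda_star lambda n.+1.
Proof.
by move=> n1; rewrite {1}/Lambda_star infsum_recl ?addrK//; exact: lambda_cvg.
Qed.

Let star_gt0 n : (1 <= n)%N -> 0 < Lambda_star lambda n.
Proof. by move=> n1; apply: Lambda_star_gt0 => //; exact: lambda_cvg. Qed.

(** Summation by parts between a decreasing weight and an increasing sum, whose
    two boundary terms are [0] at the start and nonpositive at the end. *)
Lemma finite_sum_tail_head N : 0 <= c < 1 ->
  (1 - c) * \sum_(1 <= n < N)
    lambda n * Lambda_star lambda n `^ (- c) * Lambda y n `^ p <=
  p * \sum_(1 <= n < N)
    y n * Lambda_star lambda n `^ (1 - c) * Lambda y n `^ (p - 1).
Proof.
move=> hc; pose Phi n := - (Lambda_star lambda n `^ (1 - c) * Lambda y n.-1 `^ p).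
apply: (@telescoping_sum_le _ _ _ _ _ Phi) => [n /andP[n1 _]|]; last first.
  rewrite /Phi /= Lambda0 (@powR0 _ p) ?(gt_eqF p_gt0)// mulr0 oppr0.
  by rewrite oppr_le0 mulr_ge0 ?powR_ge0.
rewrite {1}lambdaE//.
have -> : y n = Lambda y n - Lambda y n.-1.
  by rewrite (LambdaE y n1) addrAC subrr add0r.
rewrite /Phi /= opprK [X in _ <= _ + X]addrC.
by apply: step_lt1; rewrite ?star_gt0 ?Lambda_gt0 ?Lambda_ge0 ?(ltW (star_gt0 _)).
Qed.

(** Only the tail of [y] is cut off, not the one of [lambda]: since [1 - c < 0],
    truncated weights would make the summands on the right larger than those of
    the full series. *)
Lemma finite_sum_tail_tail N : 1 < c <= p ->
  (c - 1) * \sum_(1 <= n < N)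
    lambda n * Lambda_star lambda n `^ (- c) * (\sum_(n <= k < N) y k) `^ p <=
  p * \sum_(1 <= n < N)
    y n * Lambda_star lambda n `^ (1 - c) * (\sum_(n <= k < N) y k) `^ (p - 1).
Proof.
move=> hc; pose Phi n := Lambda_star lambda n `^ (1 - c) * tail N n `^ p.
apply: (@telescoping_sum_le _ _ _ _ _ Phi) => [n /andP[n1 nN]|]; last first.
  rewrite /Phi /tail (@big_geq _ _ _ N N)// (@powR0 _ p) ?(gt_eqF p_gt0)// mulr0.
  by rewrite mulr_ge0 ?powR_ge0.
rewrite {1}lambdaE//.
have -> : y n = tail N n - tail N n.+1 by rewrite (tailE nN) addrK.
apply: step_gt1; rewrite ?star_gt0 ?tail_ge0 ?(ltW (star_gt0 _)) ?tail_gt0 ?n1//.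
by move=> E; have := star_gt0 (ltn0Sn n); rewrite E ltxx.
Qed.

End FiniteInequalities.

(** * Homogeneity of the summands and the main result *)

Lemma powR_average (R : realType) (a q L S : R) : 0 < L -> 0 <= S ->
  L `^ a * (1 / L * S) `^ q = L `^ (a - q) * S `^ q.
Proof.
move=> L0 S0; rewrite div1r powRM ?invr_ge0 ?(ltW L0)// mulrA; congr (_ * _).
rewrite -powR_inv1 ?(ltW L0)// -powRrM mulN1r -powRD//.
by rewrite (gt_eqF L0) implybT.
Qed.

Lemma power_summandE (R : realType) (p c l L S : R) : 0 < L -> 0 <= S ->
  l * L `^ (p - c) * (1 / L * S) `^ p = l * L `^ (- c) * S `^ p.
Proof.
move=> L0 S0; rewrite -mulrA powR_average// mulrA.
by congr (_ * _ `^ _ * _); ring.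
Qed.

Lemma mixed_summandE (R : realType) (p c l x L S : R) : 0 < L -> 0 <= S ->
  l * L `^ (p - c) * x * (1 / L * S) `^ (p - 1) =
  l * x * L `^ (1 - c) * S `^ (p - 1).
Proof.
move=> L0 S0; rewrite [l * _ * x]mulrAC -[LHS]mulrA powR_average// mulrA.
by congr (_ * _ `^ _ * _); ring.
Qed.

Theorem theorem1p9 (R : realType) (p c : R) (lambda x : nat -> R)
    (hp : 1 < p)
    (hlambda : forall n : nat, (1 <= n)%N -> 0 < lambda n)
    (hx : forall n : nat, (1 <= n)%N -> 0 < x n) :
  let L := Lambda lambda in
  let L' := Lambda_star lambda in
  let a := A lambda x in
  let a' := A_star lambda x in
  let head n := \sum_(1 <= k < n.+1) lambda k * x k in
  let tail n := infsum n (fun k => lambda k * x k) in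
  [/\ (* (1) *)
      1 < c <= p ->
      let lhs n := lambda n * L n `^ (p - c) * a n `^ p in
      let rhs n := lambda n * L n `^ (p - c) * x n * a n `^ (p - 1) in
      converges 1 lhs -> converges 1 rhs ->
      infsum 1 lhs <= p / (c - 1) * infsum 1 rhs,
      (* (2) *)
      0 <= c < 1 ->
      let lhs n := lambda n * L n `^ (p - c) * (1 / L n * tail n) `^ p in
      let rhs n :=
        lambda n * L n `^ (p - c) * x n * (1 / L n * tail n) `^ (p - 1) in
      (forall n : nat, (1 <= n)%N -> converges n (fun k => lambda k * x k)) ->
      converges 1 lhs -> converges 1 rhs ->
      infsum 1 lhs <= p / (1 - c) * infsum 1 rhs,
      (* (3) *)
      0 <= c < 1 ->
      let lhs n := lambda n * L' n `^ (p - c) * (1 / L' n * head n) `^ p in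
      let rhs n :=
        lambda n * L' n `^ (p - c) * x n * (1 / L' n * head n) `^ (p - 1) in
      (forall n : nat, (1 <= n)%N -> converges n lambda) ->
      converges 1 lhs -> converges 1 rhs ->
      infsum 1 lhs <= p / (1 - c) * infsum 1 rhs
    & (* (4) *)
      1 < c <= p ->
      let lhs n := lambda n * L' n `^ (p - c) * a' n `^ p in
      let rhs n := lambda n * L' n `^ (p - c) * x n * a' n `^ (p - 1) in
      (forall n : nat, (1 <= n)%N -> converges n lambda) ->
      (forall n : nat, (1 <= n)%N ->
        converges n (fun k => lambda k * x k / L' n)) ->
      converges 1 lhs -> converges 1 rhs ->
      infsum 1 lhs <= p / (c - 1) * infsum 1 rhs].
Proof.
move=> L L' a a' head tail.
have y_gt0 n : (1 <= n)%N -> 0 < lambda n * x n.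
  by move=> n1; rewrite mulr_gt0 ?hlambda ?hx.
have L_gt0 n : (1 <= n)%N -> 0 < L n by exact: Lambda_gt0.
have head_ge0 n : 0 <= head n by exact: Lambda_ge0.
have p_ge0 : 0 <= p by lra.
have pm1_ge0 : 0 <= p - 1 by lra.
have ge0 (V : nat -> R) t n : (1 <= n)%N -> 0 <= lambda n * V n `^ t.
  by move=> n1; rewrite mulr_ge0 ?powR_ge0// ltW ?hlambda.
have yge0 (V : nat -> R) t n : (1 <= n)%N -> 0 <= lambda n * x n * V n `^ t.
  by move=> n1; rewrite mulr_ge0 ?powR_ge0// ltW ?y_gt0.
have L'_gt0 : (forall n, (1 <= n)%N -> converges n lambda) ->
    forall n, (1 <= n)%N -> 0 < L' n.
  by move=> cl n n1; apply: Lambda_star_gt0 => //; exact: cl.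
have tail_ge0 : (forall n, (1 <= n)%N -> converges n (fun k => lambda k * x k)) ->
    forall n, (1 <= n)%N -> 0 <= tail n.
  by move=> cy n n1; apply/ltW/(Lambda_star_gt0 y_gt0) => //; exact: cy.
split=> hc lhs rhs.
- have aE n : a n = 1 / L n * head n.
    by rewrite /a /A -mulr_suml mulrC div1r.
  have lhsE n : (1 <= n)%N -> lhs n = lambda n * L n `^ (- c) * head n `^ p.
    by move=> n1; rewrite /lhs aE power_summandE ?L_gt0.
  have rhsE n : (1 <= n)%N ->
      rhs n = lambda n * x n * L n `^ (1 - c) * head n `^ (p - 1).
    by move=> n1; rewrite /rhs aE mixed_summandE ?L_gt0.
  move=> /(eq_converges lhsE) cl /(eq_converges rhsE) cr.
  rewrite (eq_infsum lhsE) (eq_infsum rhsE).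
  apply: infsum_le_of_partial_sums => //; first by lra.
    by move=> n n1; rewrite mulr_ge0 ?powR_ge0// yge0.
  by move=> N; exact: finite_sum_head_head.
- move=> cy.
  have lhsE n : (1 <= n)%N -> lhs n = lambda n * L n `^ (- c) * tail n `^ p.
    by move=> n1; rewrite /lhs power_summandE ?L_gt0 ?tail_ge0.
  have rhsE n : (1 <= n)%N ->
      rhs n = lambda n * x n * L n `^ (1 - c) * tail n `^ (p - 1).
    by move=> n1; rewrite /rhs mixed_summandE ?L_gt0 ?tail_ge0.
  move=> /(eq_converges lhsE) cl /(eq_converges rhsE) cr.
  rewrite (eq_infsum lhsE) (eq_infsum rhsE).
  apply: infsum_le_of_truncations => //; [by lra|exact: ge0|exact: yge0|].
  by move=> N; exact: finite_sum_head_tail.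
- move=> cl.
  have lhsE n : (1 <= n)%N -> lhs n = lambda n * L' n `^ (- c) * head n `^ p.
    by move=> n1; rewrite /lhs power_summandE ?L'_gt0.
  have rhsE n : (1 <= n)%N ->
      rhs n = lambda n * x n * L' n `^ (1 - c) * head n `^ (p - 1).
    by move=> n1; rewrite /rhs mixed_summandE ?L'_gt0.
  move=> /(eq_converges lhsE) cf /(eq_converges rhsE) cr.
  rewrite (eq_infsum lhsE) (eq_infsum rhsE).
  apply: infsum_le_of_partial_sums => //; first by lra.
    by move=> n n1; rewrite mulr_ge0 ?powR_ge0// yge0.
  by move=> N; exact: finite_sum_tail_head.
- move=> cl cyL.
  have cy n : (1 <= n)%N -> converges n (fun k => lambda k * x k).
    move=> n1; have := @convergesMr R n _ (L' n) (cyL _ n1).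
    by apply: eq_converges => k _; rewrite divfK// gt_eqF// L'_gt0.
  have a'E n : (1 <= n)%N -> a' n = 1 / L' n * tail n.
    by move=> n1; rewrite /a' /A_star infsumMr ?div1r 1?mulrC//; exact: cy.
  have lhsE n : (1 <= n)%N -> lhs n = lambda n * L' n `^ (- c) * tail n `^ p.
    by move=> n1; rewrite /lhs a'E// power_summandE ?L'_gt0 ?tail_ge0.
  have rhsE n : (1 <= n)%N ->
      rhs n = lambda n * x n * L' n `^ (1 - c) * tail n `^ (p - 1).
    by move=> n1; rewrite /rhs a'E// mixed_summandE ?L'_gt0 ?tail_ge0.
  move=> /(eq_converges lhsE) cf /(eq_converges rhsE) cr.
  rewrite (eq_infsum lhsE) (eq_infsum rhsE).
  apply: infsum_le_of_truncations => //; [by lra|exact: ge0|exact: yge0|].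
  by move=> N; exact: finite_sum_tail_tail.
Qed.
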